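(* For every $\gamma\in(0,1]$ and $\alpha\geq\gamma$, the approximation ratio of the greedy algorithm on the class $\tilde{\mathcal{F}}_{\gamma,\alpha}$ of monotone, weakly $\gamma$-$\alpha$-augmentable functions is at most $\frac{\alpha}{\gamma}\cdot\frac{e^{\alpha}}{e^{\alpha}-1}$.
   Context: All functions are set functions $f\colon 2^{U}\to\mathbb{R}_{\geq0}$ on some finite ground set $U$; $f$ is monotone if $X\subseteq Y$ implies $f(X)\leq f(Y)$. Write $[n]=\{1,\dots,n\}$. For $k$, $S^{*}_{k}\in\arg\max_{X\subseteq U,|X|\leq k}f(X)$. The greedy algorithm produces $x_1,x_2,\dots$ with $x_i\in\arg\max_{x\in U\setminus\{x_1,\dots,x_{i-1}\}} f(\{x_1,\dots,x_{i-1}\}\cup\{x\})$, and $S^{G}_i=\{x_1,\dots,x_i\}$, $S^{G}_0=\emptyset$; ties are broken by some rule, and each function is considered together with a fixed such greedy run, to which all notions referring to greedy sets refer. $\bar{k}\in[|U|]$ is the smallest index such that $f(S^{G}_{\bar k}\cup\{x\})=f(S^{G}_{\bar k})$ for all $x\in U\setminus S^{G}_{\bar k}$. For $\gamma\in(0,1]$, $\alpha\geq\gamma$, $f$ is weakly $\gamma$-$\alpha$-augmentable if for all $X\in\{S^{G}_0,\dots,S^{G}_{\bar k}\}$ and all $Y\subseteq U$ with $Y\nsubseteq X$ there is $y\in Y$ with $f(X\cup\{y\})-f(X)\geq\frac{\gamma f(X\cup Y)-\alpha f(X)}{|Y|}$. $\tilde{\mathcal{F}}_{\gamma,\alpha}$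 is the set of monotone weakly $\gamma$-$\alpha$-augmentable functions. The approximation ratio of the greedy algorithm on a class $\mathcal{F}$ is $\sup_{f\in\mathcal{F}}\max_{k\in[|U|]} f(S^{*}_{k})/f(S^{G}_{k})$. *)

(* Defs.v *)
From HB Require Import structures.
From mathcomp Require Import all_boot all_order all_algebra.
From mathcomp Require Import all_classical all_reals all_analysis.

Set Implicit Arguments.
Unset Strict Implicit.
Unset Printing Implicit Defensive.

Import Order.TTheory GRing.Theory Num.Theory.
Local Open Scope ring_scope.

Section GreedyOnOneFunction.
Variables (R : realType) (U : finType).
Implicit Types (f : {set U} -> R) (x : 'I_#|U| -> U).

Definition set_monotone f := forall X Y : {set U}, X \subset Y -> f X <= f Y.

(* A greedy run x_1, ..., x_|U| is stored with indices shifted by one: the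
   element x_i is x (i - 1); hence S^G_i = greedy_set x i. *)
Definition greedy_set x (i : nat) : {set U} :=
  [set x j | j : 'I_#|U| & (j < i)%N]%SET.

Definition greedy_run f x := forall i : 'I_#|U|,
  x i \notin greedy_set x i /\
  forall y, y \notin greedy_set x i ->
    f (y |: greedy_set x i)%SET <= f (x i |: greedy_set x i)%SET.

Definition saturated f x (k : nat) : bool :=
  [forall y, (y \notin greedy_set x k) ==>
     (f (y |: greedy_set x k)%SET == f (greedy_set x k))].

(* When U is nonempty and x is a greedy run, the default ord_max = |U| itself
   satisfies the condition, so this is the smallest index in [|U|] that does. *)
Definition kbar f x : nat :=
  [arg min_(k < ord_max : 'I_#|U|.+1 | (0 < k)%N && saturated f x k) k]%N.

Definition weakly_augmentable (gamma alpha : R) f x :=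
  forall i : nat, (i <= kbar f x)%N ->
  forall Y : {set U}, ~~ (Y \subset greedy_set x i) ->
  exists2 y, y \in Y &
    f (y |: greedy_set x i)%SET - f (greedy_set x i) >=
      (gamma * f (greedy_set x i :|: Y)%SET - alpha * f (greedy_set x i))
        / #|Y|%:R.

Definition opt_set f (k : nat) : {set U} :=
  [arg max_(X > finset.set0 | (#|X| <= k)%N) f X]%O.

(* Division is that of \bar R: r / 0 = +oo for r > 0, and 0 / 0 = 0. *)
Definition greedy_ratio f x (k : nat) : \bar R :=
  ((f (opt_set f k))%:E / (f (greedy_set x k))%:E)%E.

Definition max_greedy_ratio f x : \bar R :=
  (\big[maxe/-oo]_(1 <= k < #|U|.+1) greedy_ratio f x k)%E.

End GreedyOnOneFunction.

(* A nonnegative set function on some finite ground set, together with the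
   greedy run fixed for it. *)
Record set_function (R : realType) := SetFunction {
  ground : finType;
  fval : {set ground} -> R;
  run : 'I_#|ground| -> ground;
  fval_ge0 : forall X, 0 <= fval X;
  run_greedy : greedy_run fval run }.

(* A class of functions is a plain Prop-valued predicate: universe constraints
   rule out the type [set (set_function R)]. *)
Definition weakly_augmentable_class (R : realType) (gamma alpha : R)
    (F : set_function R) : Prop :=
  set_monotone (@fval R F) /\
  weakly_augmentable gamma alpha (@fval R F) (@run R F).

Definition approximation_ratio (R : realType) (C : set_function R -> Prop) :
    \bar R :=
  ereal_sup [set r | exists2 F : set_function R,
    C F & max_greedy_ratio (@fval R F) (@run R F) = r]%classic.

(* Main.v *)
Require Import Defs.
From HB Require Import structures.
From mathcomp Require Import all_boot all_order all_algebra.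
From mathcomp Require Import all_classical all_reals all_analysis.
From mathcomp Require Import ring lra.

Import Order.TTheory GRing.Theory Num.Theory.
Local Open Scope ring_scope.

(** For a competitor [O] with [#|O| <= k], put [D i := gamma f(O) - alpha f(S_i)].
    Augmentability, applied to [S_i] and [O], gives [D (i+1) <= (1 - alpha/k) D i]
    while [D i > 0], and monotonicity keeps [D] nonpositive afterwards; since
    [1 - t <= exp(-t)], this yields [D k <= exp(-alpha) gamma f(O)].  If the run
    saturates before step [k], augmentability at the saturation point already
    gives [D <= 0]. *)

Section Greedy.
Set Implicit Arguments.
Unset Strict Implicit.
Variables (R : realType) (U : finType) (f : {set U} -> R) (x : 'I_#|U| -> U).
Hypotheses (f_ge0 : forall X, 0 <= f X) (f_greedy : greedy_run f x).
Hypothesis f_mono : set_monotone f.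

Local Notation S := (greedy_set x).

Lemma greedy_set_mono i j : (i <= j)%N -> S i \subset S j.
Proof.
move=> ij; apply/fintype.subsetP => y /imsetP[m]; rewrite inE => mi ->.
by apply: imset_f; rewrite inE; apply: leq_trans ij.
Qed.

Lemma greedy_setS (i : 'I_#|U|) : S i.+1 = (x i |: S i)%SET.
Proof.
apply/setP => y; rewrite !inE; apply/imsetP/orP => [[m]|[/eqP->|/imsetP[m]]].
- rewrite inE ltnS leq_eqVlt => /orP[/eqP/val_inj -> ->|mi ->]; first by left.
  by right; apply: imset_f; rewrite inE.
- by exists i; rewrite // inE.
- by rewrite inE => mi ->; exists m; rewrite // inE ltnW.
Qed.

Lemma greedy_run_inj : injective x.
Proof.
have neq (i j : 'I_#|U|) : (i < j)%N -> x i <> x j.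
  move=> ij e; have [+ _] := f_greedy j.
  by rewrite -e => /negP; apply; apply: imset_f; rewrite inE.
move=> i j e; apply: val_inj; case: (ltngtP i j) => // h; case: (neq _ _ h) => //.
Qed.

Lemma greedy_set_full : S #|U| = [set: U]%SET.
Proof.
apply/eqP; rewrite eqEcard finset.subsetT card_imset; last exact: greedy_run_inj.
rewrite cardsT -[leqLHS]card_ord; apply/subset_leq_card/fintype.subsetP => j _.
by rewrite inE ltn_ord.
Qed.

(** The specification of [arg min] applies only if its default [ord_max] is admissible. It is: the
    run is injective, so [S #|U|] is all of [U] and saturation there is vacuous. *)
Lemma saturated_kbar : (0 < #|U|)%N -> saturated f x (kbar f x).
Proof.
move=> U0; rewrite /kbar; case: arg_minnP => [|k /andP[]//].
rewrite /= U0 /=; apply/forallP => y.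
by rewrite greedy_set_full finset.in_setT.
Qed.

Lemma greedy_gain (i : 'I_#|U|) y : f (y |: S i)%SET <= f (S i.+1).
Proof.
rewrite greedy_setS; have [yS|/(proj2 (f_greedy i))//] := boolP (y \in S i).
by apply: f_mono; rewrite finset.subUset finset.sub1set inE yS orbT finset.subsetUr.
Qed.

Lemma kbar_gain y : (0 < #|U|)%N ->
  f (y |: S (kbar f x))%SET = f (S (kbar f x)).
Proof.
move=> U0; have [yS|yS] := boolP (y \in S (kbar f x)).
  by congr f; apply/finset.setUidPr; rewrite finset.sub1set.
by have /forallP/(_ y)/implyP/(_ yS)/eqP := saturated_kbar U0.
Qed.

Section Augmentable.
Variables (gamma alpha : R).
Hypotheses (gamma_gt0 : 0 < gamma) (gamma_le_alpha : gamma <= alpha).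
Hypothesis f_aug : weakly_augmentable gamma alpha f x.

Variables (O : {set U}) (k : nat).
Hypothesis card_O : (#|O| <= k)%N.

Let D i : R := gamma * f O - alpha * f (S i).

Let alpha_gt0 : 0 < alpha. Proof. exact: lt_le_trans gamma_le_alpha. Qed.

Lemma deficit_nonincreasing i j : (i <= j)%N -> D j <= D i.
Proof. by move=> ij; rewrite lerB// ler_pM2l// f_mono// greedy_set_mono. Qed.

(** If [O] were inside [S i], monotonicity and [gamma <= alpha] would give [D i <= 0], so
    augmentability applies. Its numerator is at least [D i] because [f O <= f (S i :|: O)]. *)
Lemma deficit_gain i : (i <= kbar f x)%N -> 0 < D i ->
  exists y, D i <= #|O|%:R * (f (y |: S i)%SET - f (S i)).
Proof.
move=> ik Di; have OS : ~~ (O \subset S i).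
  apply/negP => /f_mono OS; move: Di; rewrite /D subr_gt0 ltNge => /negP; apply.
  by apply: ler_pM => //; exact: ltW.
have [y yO gain] := f_aug ik OS; exists y.
have O0 : 0 < #|O|%:R :> R by rewrite ltr0n; apply/card_gt0P; exists y.
move: gain; rewrite ler_pdivrMr// => gain; rewrite mulrC (le_trans _ gain)// /D.
by rewrite lerB// ler_pM2l// f_mono// finset.subsetUr.
Qed.

Lemma deficit_step (i : 'I_#|U|) : (i <= kbar f x)%N -> (0 < k)%N -> 0 < D i ->
  D i.+1 <= expR (- (alpha / k%:R)) * D i.
Proof.
move=> ik k0 Di; have [y Hy] := deficit_gain ik Di.
have kR : 0 < k%:R :> R by rewrite ltr0n.
have gain : D i <= k%:R * (f (S i.+1) - f (S i)).
  (* Replacing [#|O|] by the larger [k] is sound because marginal gains are nonnegative. *)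
  apply: le_trans Hy _; apply: ler_pM; rewrite ?ler_nat//.
    by rewrite subr_ge0 f_mono// finset.subsetUr.
  by rewrite lerB// greedy_gain.
(* This factor is negative when [alpha > k]; the exponential above it is not, which lets the
   induction multiply the bounds. *)
apply: (@le_trans _ _ ((1 - alpha / k%:R) * D i)).
  have : alpha * (D i / k%:R) <= alpha * (f (S i.+1) - f (S i)).
    by rewrite ler_pM2l// ler_pdivrMr// mulrC.
  by rewrite /D; lra.
by rewrite ler_pM2r// expR_ge1Dx.
Qed.

(** The range reaches one past [kbar] because augmentability still holds at [S (kbar f x)], from
    where a last step can be taken. *)
Lemma deficit_decay i : (0 < k)%N -> (i <= #|U|)%N -> (i <= (kbar f x).+1)%N ->
  D i <= expR (- (alpha / k%:R)) ^+ i * (gamma * f O).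
Proof.
move=> k0; elim: i => [_ _|i IH iU ik].
  by rewrite expr0 mul1r gerBl mulr_ge0// ltW.
have [Di|Di] := leP (D i) 0.
  rewrite (le_trans (deficit_nonincreasing (leqnSn i)))// (le_trans Di)//.
  by rewrite mulr_ge0 ?exprn_ge0 ?expR_ge0// mulr_ge0// ltW.
apply: le_trans (@deficit_step (Ordinal iU) ik k0 Di) _.
by rewrite exprS -mulrA ler_wpM2l ?expR_ge0// IH ?(ltnW iU) ?(ltnW ik).
Qed.

Lemma deficit_kbar_le0 : (0 < #|U|)%N -> D (kbar f x) <= 0.
Proof.
move=> U0; rewrite leNgt; apply/negP => D0.
have [y] := deficit_gain (leqnn _) D0.
by rewrite kbar_gain// subrr mulr0 leNgt D0.
Qed.

Lemma deficit_final : (0 < k <= #|U|)%N -> D k <= expR (- alpha) * (gamma * f O).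
Proof.
move=> /andP[k0 kU]; have [kk|kk] := leqP k (kbar f x).
  have := deficit_decay k0 kU (leqW kk).
  (* The [k] factors combine to the exponent [k * (alpha / k) = alpha]. *)
  rewrite -expRM_natl mulrN [k%:R * _]mulrC divfK//.
  by rewrite pnatr_eq0 -lt0n.
rewrite (le_trans (deficit_nonincreasing (ltnW kk)))//.
rewrite (le_trans (deficit_kbar_le0 (leq_trans k0 kU)))//.
by rewrite mulr_ge0 ?expR_ge0// mulr_ge0// ltW.
Qed.

Lemma greedy_guarantee : (0 < k <= #|U|)%N ->
  f O <= alpha / gamma * (expR alpha / (expR alpha - 1)) * f (S k).
Proof.
move=> /deficit_final; rewrite /D expRN => H.
have e1 : 0 < expR alpha - 1 by rewrite subr_gt0 expR_gt1.
have e0 := expR_gt0 alpha.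
have : expR alpha * (gamma * f O - alpha * f (S k)) <= gamma * f O.
  by rewrite -ler_pdivlMl.
move=> {}H.
(* Clearing denominators leaves a rearrangement of [H], linear in the products that occur. *)
rewrite -(@ler_pM2l _ (gamma * (expR alpha - 1))) ?mulr_gt0//.
have -> : gamma * (expR alpha - 1) *
    (alpha / gamma * (expR alpha / (expR alpha - 1)) * f (S k)) =
    alpha * expR alpha * f (S k) by field; rewrite !gt_eqF.
lra.
Qed.

End Augmentable.
End Greedy.

Lemma card_opt_set (R : realType) (U : finType) (f : {set U} -> R) k :
  (#|opt_set f k| <= k)%N.
Proof. by rewrite /opt_set; case: arg_maxP; rewrite ?finset.cards0. Qed.

(** A zero denominator forces [a = 0], and then the quotient is [0 / 0 = 0] rather than [+oo]. *)
Lemma lee_fin_div (R : realType) (a b c : R) : 0 <= c -> 0 <= a -> 0 <= b ->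
  a <= c * b -> (a%:E / b%:E <= c%:E)%E.
Proof.
move=> c0 a0; rewrite le_eqVlt => /predU1P[<-|b0] acb.
  have /eqP -> : a == 0 by rewrite eq_le a0 andbT -(mulr0 c).
  by rewrite mul0e lee_fin.
by rewrite inver gt_eqF// -EFinM lee_fin ler_pdivrMr.
Qed.

Theorem theorem19 (R : realType) (gamma alpha : R)
    (gamma_gt0 : 0 < gamma) (gamma_le1 : gamma <= 1)
    (gamma_le_alpha : gamma <= alpha) :
  (approximation_ratio (weakly_augmentable_class gamma alpha) <=
     (alpha / gamma * (expR alpha / (expR alpha - 1)))%:E)%E.
Proof.
have alpha_gt0 : 0 < alpha by exact: lt_le_trans gamma_le_alpha.
apply: ge_ereal_sup => _ [F [mono aug] <-].
rewrite /max_greedy_ratio big_nat.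
(* The neutral value [-oo] also covers an empty ground set, where no [k] is in range. *)
apply: (big_ind (fun r => r <= _)%E) => [|a b|k]; first exact: leNye.
  by rewrite ge_max => -> ->.
rewrite ltnS => kU; apply: lee_fin_div; rewrite ?fval_ge0//.
  by rewrite ltW// !mulr_gt0 ?invr_gt0 ?subr_gt0 ?expR_gt1 ?expR_gt0.
apply: greedy_guarantee => //; [exact: fval_ge0|exact: run_greedy|].
exact: card_opt_set.
Qed.
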